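(* Let $0<p<1$, $f=p/(1-p)$, and for $n\ge 1$ let $Y_n\sim W(n,p)$ be weaver-distributed, with values $y_k=y_{k,n}=k/(2^n-1)$, probabilities $p_k=p_{k,n}$ ($k=0,\ldots,2^n-1$), probability vector ${\bf p}_n=(p_{0,n},\ldots,p_{2^n-1,n})$ and distribution function $F_n$. For $n=0$ set $y_{0,0}=p$, $p_{0,0}=1$, ${\bf p}_0=(1)$. (i) For all $n\ge 0$, ${\bf p}_{n+1}=((1-p){\bf p}_n,\;p\,{\bf p}_n)$ (concatenation). Equivalently, starting with mass $1$ in row $0$, row $n+1$ is obtained from row $n$ by replacing each entry $x$ by the two consecutive entries $(1-p)x,\ p x$. (ii) If $p>1/2$, the sequence $p_0,fp_0,f^2p_0,\ldots$ increases, the mode of $W(n,p)$ is at one, and its median is larger than $1/2$. If $p<1/2$, the sequence decreases, the mode is at zero, and the median is smaller than $1/2$. If $p=1/2$, all probabilities coincide, i.e. $W(n,1/2)$ is the discrete uniform distribution on the values $y_k=k/(2^n-1)$, with $p_k=1/2^n$ for $k=0,1,\ldots,2^n-1$. (iii) If $Y\sim W(n,p)$ and $Y'\sim W(n,1-p)$, then $P(Y=y_k)=P(Y'=y_{2^n-1-k})$ for $k=0,\ldots,2^n-1$. (iv) For $n\ge 0$ and $k=0,\ldots,2^n$ let $v_{k,n}=k/2^n$. For every fixed $n$ and $0<k<2^n$, the mass that $W(m,p)$ assigns to the left and to the right of $v_{k,n}$ is the same for every $m\ge n$, and so is the value $F_m(v_{k,n})$. In particular, $F_m(1/2)=1-p$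 for all $m\ge 1$; $F_m(1/4)=(1-p)^2$ and $F_m(3/4)=1-p^2$ for all $m\ge 2$; $F_m(1/8)=(1-p)^3$, $F_m(3/8)=(1-p)^2+p(1-p)^2$, $F_m(5/8)=(1-p)+p(1-p)^2$ and $F_m(7/8)=1-p^3$ for all $m\ge 3$. (v) For every $n\ge 0$ and $k=0,\ldots,2^n-1$, the total mass that $W(m,p)$ assigns to the interval $[v_{k,n},v_{k+1,n}]$ equals $p_{k,n}$ for all $m\ge n$. For $m=n$ it is located at the point $y_{k,n}$. Thus $W(n,p)$ is a discretisation of the density of the $n$-th stage of the classical $p$ model: both assign the same mass to each interval $[v_{k,n},v_{k+1,n}]$. (vi) For $n\ge1$, $F_n$ has $2^n$ points of discontinuity. If $p=1/2$, all jumps have the same height $1/2^n$. Otherwise there are $n+1$ different jump sizes $h_j=p^j(1-p)^{n-j}$, $j=0,\ldots,n$, and their multiplicities are binomial: there are exactly $\binom{n}{j}$ jumps of size $h_j$.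
   Context: Weaver's distribution $W(n,p)$ ($n\ge 1$, $0<p<1$): the discrete distribution on the points $y_{k,n}=k/(2^n-1)$, $k=0,\ldots,2^n-1$, with probabilities $p_{k,n}=p^{\#1}(1-p)^{\#0}$, where $\#1$ and $\#0$ are the numbers of ones and zeros in the $n$-digit binary representation of $k$. For $n=0$ it is read as the unit mass at the point $p$. Classical $p$ model: start with the uniform distribution on $(0,1)$; at each step halve every interval, giving the proportion $1-p$ of its mass to the left half and the proportion $p$ to the right half, spread uniformly in each half. After $n$ steps this yields a distribution with a density that is constant on each interval $(k/2^n,(k+1)/2^n)$, $k=0,\ldots,2^n-1$. *)

(* Defs.v *)
From HB Require Import structures.
From mathcomp Require Import all_boot all_order all_algebra.
From mathcomp Require Import all_classical all_reals all_analysis.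

Set Implicit Arguments.
Unset Strict Implicit.
Unset Printing Implicit Defensive.

Import Order.TTheory GRing.Theory Num.Theory.
Import numFieldNormedType.Exports.

Local Open Scope classical_set_scope.
Local Open Scope ring_scope.

(* The n binary digits of k, least significant first (k is meant to be
   < 2 ^ n); an order-independent count is all that is used. *)
Definition bin_digits (n k : nat) : seq bool :=
  mkseq (fun i => odd (k %/ 2 ^ i)) n.

Section weaver.
Context {R : realType} (p : R).

(* For n = 0 the formula k / (2 ^ n - 1) makes no sense and the only point
   is p. *)
Definition weaver_pt (n k : nat) : R :=
  if n == 0%N then p else k%:R / (2 ^ n - 1)%N%:R.

Definition weaver_pmf (n k : nat) : R :=
  p ^+ count_mem true (bin_digits n k) *
  (1 - p) ^+ count_mem false (bin_digits n k).

Definition weaver_vec (n : nat) : seq R := mkseq (weaver_pmf n) (2 ^ n).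

(* The value outside 0 <= p <= 1 is a dummy that makes weaver_prob a
   probability measure for every p, as for the library's binomial_prob. *)
Definition weaver_prob (n : nat) : set R -> \bar R := fun A =>
  if 0 <= p <= 1 then
    (\sum_(k < 2 ^ n) (weaver_pmf n k)%:E * \d_(weaver_pt n k) A)%E
  else \d_p A.

Lemma bin_digitsS n k : bin_digits n.+1 k = odd k :: bin_digits n k./2.
Proof.
rewrite /bin_digits /mkseq /= expn0 divn1; congr cons.
rewrite -[1%N]addn0 iotaDl -map_comp; apply: eq_map => i /=.
by rewrite add1n expnS divnMA divn2.
Qed.

Lemma weaver_pmfS n k :
  weaver_pmf n.+1 k = (if odd k then p else 1 - p) * weaver_pmf n k./2.
Proof.
rewrite /weaver_pmf bin_digitsS /=.
case: (odd k) => /=; rewrite add1n add0n exprS; first by rewrite mulrA.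
by rewrite mulrCA.
Qed.

Lemma weaver_pmf_ge0 n k : 0 <= p <= 1 -> 0 <= weaver_pmf n k.
Proof. by move=> /andP[p0 p1]; rewrite mulr_ge0// exprn_ge0// subr_ge0. Qed.

Lemma sum_weaver_pmf n : \sum_(k < 2 ^ n) weaver_pmf n k = 1.
Proof.
rewrite -(big_mkord xpredT); elim: n => [|n IH].
  by rewrite expn0 big_nat1 /weaver_pmf /= !expr0 mulr1.
have double N (F : nat -> R) :
    \sum_(0 <= k < N.*2) F k = \sum_(0 <= k < N) (F k.*2 + F k.*2.+1).
  elim: N => [|N IHN]; first by rewrite !big_geq.
  by rewrite doubleS !big_nat_recr//= IHN addrA.
rewrite expnS mul2n double -[RHS]IH; apply: eq_bigr => k _.
rewrite !weaver_pmfS /= odd_double /= doubleK uphalf_double.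
by rewrite -mulrDl subrK mul1r.
Qed.

Lemma weaver_prob_measure n : 0 <= p <= 1 ->
  exists mu : {measure set R -> \bar R},
    weaver_prob n = mu.
Proof.
move=> p01; pose w k := NngNum (weaver_pmf_ge0 n k p01).
exists (msum (fun k => mscale (w k)
  (\d_(weaver_pt n k) : {measure set R -> \bar R})) (2 ^ n)).
by apply/funext => A; rewrite /weaver_prob p01 /msum /mscale.
Qed.

Section weaver_probability.
Variable n : nat.

Let weaver0 : weaver_prob n set0 = 0%E.
Proof.
rewrite /weaver_prob; case: ifPn => _; last by rewrite measure0.
by rewrite big1// => k _; rewrite measure0 mule0.
Qed.

Let weaver_ge0 A : (0 <= weaver_prob n A)%E.
Proof.
rewrite /weaver_prob; case: ifPn => // p01.
by apply: sume_ge0 => k _; rewrite mule_ge0// lee_fin weaver_pmf_ge0.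
Qed.

Let weaver_sigma_additive : semi_sigma_additive (weaver_prob n).
Proof.
have [p01|p01] := boolP (0 <= p <= 1).
  by have [mu ->] := weaver_prob_measure n p01; exact: measure_semi_sigma_additive.
rewrite (_ : weaver_prob n = \d_p); first exact: measure_semi_sigma_additive.
by apply/funext => A; rewrite /weaver_prob (negbTE p01).
Qed.

HB.instance Definition _ := isMeasure.Build _ _ _ (weaver_prob n)
  weaver0 weaver_ge0 weaver_sigma_additive.

Let weaver_setT : weaver_prob n [set: _] = 1%E.
Proof.
rewrite /weaver_prob; case: ifPn => _; last by rewrite diracT.
under eq_bigr do rewrite diracT mule1.
by rewrite sumEFin sum_weaver_pmf.
Qed.

HB.instance Definition _ :=
  @Measure_isProbability.Build _ _ R (weaver_prob n) weaver_setT.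

End weaver_probability.

End weaver.

Definition idR {R : realType} : R -> R := idfun.

HB.instance Definition _ (R : realType) :=
  @isMeasurableFun.Build _ _ _ _ (@idR R) (@measurable_id _ _ setT).

Definition weaver_cdf {R : realType} (p : R) (n : nat) (x : R) : R :=
  fine (cdf (idR : {RV (weaver_prob p n) >-> R}) x).

Section pmodel.
Context {R : realType}.

Definition dyadic (n k : nat) : R := k%:R / 2 ^+ n.

(* Mass of the interval (k / 2 ^ n, (k + 1) / 2 ^ n) after n steps: its parent
   is the interval of index k./2, of which it is the right half iff k is odd. *)
Fixpoint pmodel_mass (p : R) (n k : nat) : R :=
  if n is m.+1 then (if odd k then p else 1 - p) * pmodel_mass p m k./2 else 1.

Definition pmodel_density (p : R) (n : nat) (x : R) : R :=
  \sum_(k < 2 ^ n) pmodel_mass p n k / (dyadic n k.+1 - dyadic n k) *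
                   \1_(`]dyadic n k, dyadic n k.+1[ : set R) x.

Definition pmodel_prob (p : R) (n : nat) (A : set R) : \bar R :=
  (\int[lebesgue_measure]_(x in A) (pmodel_density p n x)%:E)%E.

End pmodel.

Section descriptors.
Context {R : realType}.

Definition is_mode (mu : set R -> \bar R) (x : R) : Prop :=
  forall y, (mu [set y] <= mu [set x])%E.

Definition is_median (mu : set R -> \bar R) (x : R) : Prop :=
  ((2^-1)%:E <= mu `]-oo, x]%classic)%E /\ ((2^-1)%:E <= mu `[x, +oo[%classic)%E.

Definition has_law d (T : measurableType d) (P : probability T R)
    (X : {RV P >-> R}) (mu : set R -> \bar R) : Prop :=
  forall A : set R, measurable A -> distribution P X A = mu A.

Definition discontinuities (F : R -> R) : set R :=
  [set x | ~ {for x, continuous F}].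

Definition jump (F : R -> R) (x : R) : R :=
  lim (F y @[y --> x^'+]) - lim (F y @[y --> x^'-]).

End descriptors.

(* Main.v *)
Require Import Defs.
From HB Require Import structures.
From mathcomp Require Import all_boot all_order all_algebra.
From mathcomp Require Import all_classical all_reals all_analysis.
From mathcomp Require Import ring lra zify.
Set Implicit Arguments.
Unset Strict Implicit.
Unset Printing Implicit Defensive.
Import Order.TTheory GRing.Theory Num.Theory.
Import numFieldNormedType.Exports.
Local Open Scope classical_set_scope.
Local Open Scope ring_scope.

(** The mass of the [k]-th point is the product, over the [n] binary digits of [k],
    of a factor [p] for each one and [1 - p] for each zero.  Everything about the
    masses follows by manipulating digits: prepending or appending a digit gives the
    two descriptions of the rows, complementing all digits exchanges [p] and [1 - p],
    and concatenating digit strings multiplies masses ([weaver_pmf_cat]).  Summed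
    over all suffixes of length [d], the last fact says that the [2 ^ d] descendants
    of an index share exactly its mass ([sum_weaver_pmf_block]).

    The geometric input is that the [j]-th point of level [n + d] lies in
    [[k / 2 ^ n, (k + 1) / 2 ^ n]] exactly when [j] is a descendant of [k]
    ([dyadic_le_weaver_pt], [weaver_pt_le_dyadic]); interior dyadic points are
    therefore never hit, and the probabilities and distribution functions at dyadic
    points of level [n] do not depend on the level [n + d].  The density of the [p]
    model has the same mass on these intervals since both masses obey the same
    recursion on the last digit.

    For [p > 1 / 2] the largest mass is [p ^+ n], attained only at the point [1],
    and a median exceeds [1 / 2] because the mass up to [1 / 2] is [1 - p < 1 / 2].
    The case [p < 1 / 2] follows by reflection, as the law for [1 - p] is the image
    of the law for [p] under [x |-> 1 - x] ([weaver_prob_reflect]).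

    Finally the distribution function is a finite step function, whose jump at a
    point is the mass of that point ([jump_step]).  So the discontinuities are the
    [2 ^ n] support points, the jump at the [k]-th one depends only on the number of
    ones of [k], and ['C(n, j)] indices have [j] ones ([count_ones]). *)

(** * Counting binary digits *)

Definition ones (n k : nat) : nat := count_mem true (bin_digits n k).

Lemma onesS n k : ones n.+1 k = (odd k + ones n k./2)%N.
Proof. by rewrite /ones bin_digitsS /=; case: (odd k). Qed.

Lemma ones_le n k : (ones n k <= n)%N.
Proof. by rewrite (leq_trans (count_size _ _))// size_mkseq. Qed.

Lemma count_zeros n k : count_mem false (bin_digits n k) = (n - ones n k)%N.
Proof.
have := count_predC (pred1 true) (bin_digits n k); rewrite size_mkseq -/(ones n k).
rewrite (@eq_count _ (predC (pred1 true)) (pred1 false)); last by case.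
lia.
Qed.

(** Numbers below [2 N] grouped by their last digit: this turns induction on the
    number of digits into a statement on lists. *)
Lemma iota_double N :
  iota 0 N.*2 = flatten [seq [:: k.*2; k.*2.+1] | k <- iota 0 N].
Proof.
elim: N => // N IHN.
rewrite -[in RHS]addn1 iotaD map_cat flatten_cat -IHN doubleS.
by rewrite -addn2 iotaD.
Qed.

(** Splitting on the last digit gives Pascal's rule. *)
Lemma count_ones n j : count (fun k => ones n k == j) (iota 0 (2 ^ n)) = 'C(n, j).
Proof.
elim: n j => [|n IH] j; first by rewrite expn0 /=; case: j.
rewrite expnS mul2n iota_double.
have step : forall s : seq nat,
    count (fun k => ones n.+1 k == j) (flatten [seq [:: k.*2; k.*2.+1] | k <- s]) =
    (count (fun k => ones n k == j) s + count (fun k => (ones n k).+1 == j) s)%N.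
  elim=> //= k s ->; rewrite !onesS /= odd_double /= doubleK uphalf_double.
  by rewrite add0n add1n; lia.
rewrite step IH; case: j {step} => [|j].
  by rewrite !bin0 (@eq_count _ _ pred0)// count_pred0.
by rewrite IH binS addnC.
Qed.

(** * The masses as products over binary digits *)

Section Mass.
Context {R : realType}.
Implicit Types p : R.

Lemma weaver_pmfE p n k :
  weaver_pmf p n k = p ^+ ones n k * (1 - p) ^+ (n - ones n k).
Proof. by rewrite /weaver_pmf count_zeros. Qed.

Lemma weaver_pmf0 p k : weaver_pmf p 0 k = 1.
Proof. by rewrite /weaver_pmf /= !expr0 mulr1. Qed.

(** The mass is a product over the digits and the digits of [k * 2 ^ m + r] are
    those of [k] followed by those of [r], so masses multiply.  The concatenation
    rule is the case [n = 1]; summing over [r] gives the self-similarity used at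
    dyadic points. *)
Lemma weaver_pmf_cat p n m k r : (r < 2 ^ m)%N ->
  weaver_pmf p (n + m) (k * 2 ^ m + r) = weaver_pmf p n k * weaver_pmf p m r.
Proof.
elim: m r => [|m IH] r.
  by rewrite expn0 ltnS leqn0 => /eqP ->; rewrite weaver_pmf0 mulr1 addn0 muln1 addn0.
rewrite expnS => lt_r; rewrite addnS !weaver_pmfS.
rewrite (_ : odd _ = odd r); last by rewrite oddD mulnCA oddM.
rewrite (_ : _./2 = k * 2 ^ m + r./2)%N; last by lia.
by rewrite IH; [rewrite mulrCA | lia].
Qed.

Lemma weaver_vec_cat p n : weaver_vec p n.+1 =
  [seq (1 - p) * x | x <- weaver_vec p n] ++ [seq p * x | x <- weaver_vec p n].
Proof.
rewrite /weaver_vec /mkseq expnS mul2n -addnn iotaD map_cat -!map_comp add0n.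
rewrite (_ : iota (2 ^ n) _ = [seq (2 ^ n + i)%N | i <- iota 0 (2 ^ n)]); last first.
  by rewrite -iotaDl addn0.
rewrite -map_comp.
congr cat; apply/eq_in_map => k; rewrite mem_iota add0n /= => lt_k.
  by have := weaver_pmf_cat p 1 0 lt_k; rewrite add1n mul0n add0n => ->;
    rewrite weaver_pmfS weaver_pmf0 mulr1.
by have := weaver_pmf_cat p 1 1 lt_k; rewrite add1n mul1n => ->;
    rewrite weaver_pmfS weaver_pmf0 mulr1.
Qed.

Lemma weaver_vec_flatten p n : weaver_vec p n.+1 =
  flatten [seq [:: (1 - p) * x; p * x] | x <- weaver_vec p n].
Proof.
rewrite /weaver_vec /mkseq expnS mul2n iota_double map_flatten -!map_comp.
congr flatten; apply: eq_map => k /=.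
by rewrite !weaver_pmfS /= odd_double /= doubleK uphalf_double.
Qed.

(** [2 ^ n - 1 - k] is the digitwise complement of [k]. *)
Lemma weaver_pmf_reflect p n k : (k < 2 ^ n)%N ->
  weaver_pmf (1 - p) n (2 ^ n - 1 - k) = weaver_pmf p n k.
Proof.
elim: n k => [|n IH] k; first by rewrite !weaver_pmf0.
rewrite expnS !weaver_pmfS => lt_k.
rewrite (_ : odd _ = ~~ odd k); last by lia.
rewrite (_ : _./2 = 2 ^ n - 1 - k./2)%N; last by lia.
by rewrite IH; [case: (odd k); rewrite //= subKr | lia].
Qed.

(** Refining by [d] digits spreads the mass of [k] over a block of [2 ^ d]
    consecutive indices without changing its total, since the masses of the last
    [d] digits sum to [1]. *)
Lemma sum_weaver_pmf_block p n d k :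
  \sum_(k * 2 ^ d <= j < k.+1 * 2 ^ d) weaver_pmf p (n + d) j = weaver_pmf p n k.
Proof.
rewrite -{1}[(k * _)%N]add0n big_addn mulSn addnK big_mkord.
under eq_bigr => r _ do rewrite [(_ + k * _)%N]addnC weaver_pmf_cat//.
by rewrite -mulr_sumr sum_weaver_pmf mulr1.
Qed.

Lemma sum_weaver_pmf_prefix p n d k :
  \sum_(0 <= j < k * 2 ^ d) weaver_pmf p (n + d) j = \sum_(0 <= i < k) weaver_pmf p n i.
Proof. by rewrite big_nat_mul; apply: eq_bigr => i _; exact: sum_weaver_pmf_block. Qed.

Lemma pmodel_massE p n k : pmodel_mass p n k = weaver_pmf p n k.
Proof. by elim: n k => [|n IH] k; rewrite ?weaver_pmf0// weaver_pmfS /= IH. Qed.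

Lemma weaver_pmf_gt0 p n k : 0 < p -> p < 1 -> 0 < weaver_pmf p n k.
Proof. by move=> p0 p1; rewrite mulr_gt0// exprn_gt0// subr_gt0. Qed.

Lemma weaver_pmf_half n k : weaver_pmf (1 / 2 : R) n k = 1 / 2 ^+ n.
Proof.
rewrite weaver_pmfE (_ : 1 - 1 / 2 = 1 / 2 :> R); last by lra.
by rewrite -exprD subnKC ?ones_le// expr_div_n expr1n.
Qed.

Lemma weaver_pmf_last p n : weaver_pmf p n (2 ^ n - 1) = p ^+ n.
Proof.
elim: n => [|n IH]; first by rewrite weaver_pmf0.
rewrite weaver_pmfS (_ : odd _); last by have := expn_gt0 2 n; rewrite expnS; lia.
by rewrite (_ : _./2 = 2 ^ n - 1)%N ?IH -?exprS// expnS; lia.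
Qed.

Lemma weaver_pmf_le_max p n k : 1 / 2 < p -> p < 1 -> weaver_pmf p n k <= p ^+ n.
Proof.
move=> p_gt p_lt1; rewrite weaver_pmfE -[X in _ <= p ^+ X](subnKC (ones_le n k)) exprD.
by apply: ler_wpM2l; [rewrite exprn_ge0//; lra | apply: lerXn2r; rewrite ?nnegrE; lra].
Qed.

(** Some digit of [k] is zero.  If the last digit is one, the zero is among the
    leading digits and induction applies; otherwise the factor [1 - p < p] is
    already a strict loss. *)
Lemma weaver_pmf_lt_max p n k : 1 / 2 < p -> p < 1 -> (k < 2 ^ n - 1)%N ->
  weaver_pmf p n k < p ^+ n.
Proof.
move=> p_gt p_lt1; have p0 : 0 < p by lra.
elim: n k => [|n IH] k; first by lia.
rewrite expnS weaver_pmfS exprS; case: (boolP (odd k)) => odd_k lt_k.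
  by rewrite ltr_pM2l// IH//; lia.
apply: (@lt_le_trans _ _ (p * weaver_pmf p n k./2)).
  by rewrite ltr_pM2r ?weaver_pmf_gt0//; lra.
by rewrite ler_pM2l// weaver_pmf_le_max.
Qed.

End Mass.

(** * Finite step functions *)

Section StepFunction.
Context {R : realType} {I : finType} (w c : I -> R).

Let F (y : R) : R := \sum_(i | c i <= y) w i.

(** The comparison with each of the finitely many [c i] is constant on a right
    neighbourhood of [x]. *)
Lemma step_cvg_right x : F y @[y --> x^'+] --> F x.
Proof.
apply: cvg_near_cst; have : \forall y \near x^'+, forall i, (c i <= y) = (c i <= x).
  apply: filter_forall => i; have [le_cx|lt_xc] := leP (c i) x; near=> y.
    by rewrite (le_trans le_cx)// ltW//; near: y; exact: nbhs_right_gt.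
  by apply/negbTE; rewrite -ltNge; near: y; exact: nbhs_right_lt.
by apply: filterS => y eqF; apply: eq_bigl.
Unshelve. all: by end_near. Qed.

(** Just to the left of [x], the jump points below are those strictly below
    [x]. *)
Lemma step_cvg_left x : F y @[y --> x^'-] --> F x - \sum_(i | c i == x) w i.
Proof.
have -> : F x - \sum_(i | c i == x) w i = \sum_(i | c i < x) w i.
  rewrite /F (bigID (fun i => c i == x))/= (eq_bigl (fun i => c i == x)).
    rewrite addrAC subrr add0r; apply: eq_bigl => i.
    by rewrite [RHS]lt_neqAle andbC.
  by move=> i; rewrite andbC; case: eqP => //= ->; rewrite lexx.
apply: cvg_near_cst; have : \forall y \near x^'-, forall i, (c i <= y) = (c i < x).
  apply: filter_forall => i; have [lt_cx|le_xc] := ltP (c i) x; near=> y.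
    by near: y; exact: nbhs_left_ge.
  by apply/negbTE; rewrite -ltNge (lt_le_trans _ le_xc)//; near: y; exact: nbhs_left_lt.
by apply: filterS => y eqF; apply: eq_bigl.
Unshelve. all: by end_near. Qed.

Lemma jump_step x : jump F x = \sum_(i | c i == x) w i.
Proof.
rewrite /jump (cvg_lim _ (@step_cvg_right x))// (cvg_lim _ (@step_cvg_left x))//.
by rewrite opprB addrCA subrr addr0.
Qed.

Lemma discontinuities_step x :
  discontinuities F x <-> \sum_(i | c i == x) w i <> 0.
Proof.
rewrite /discontinuities /=; split; apply: contra_not.
  move=> w0; apply/left_right_continuousP; split; last exact: step_cvg_right.
  by have := @step_cvg_left x; rewrite w0 subr0.
move=> /left_right_continuousP[cl _].
have := @step_cvg_left x => /(cvg_unique (@norm_hausdorff _ R^o) cl)/esym/eqP.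
by rewrite subr_eq -subr_eq0 opprD addNKr oppr_eq0 => /eqP.
Qed.

End StepFunction.

(** * The support points *)

Section Points.
Context {R : realType}.
Implicit Types p : R.

Lemma expn2B1_gt0 n : (0 < n)%N -> 0 < (2 ^ n - 1)%N%:R :> R.
Proof. by case: n => // n _; rewrite ltr0n expnS; have := expn_gt0 2 n; lia. Qed.

Lemma weaver_ptE p n k : (0 < n)%N -> weaver_pt p n k = k%:R / (2 ^ n - 1)%N%:R.
Proof. by rewrite /weaver_pt; case: n. Qed.

Lemma weaver_pt_inj p n j k : (j < 2 ^ n)%N -> (k < 2 ^ n)%N ->
  weaver_pt p n j = weaver_pt p n k -> j = k.
Proof.
have [->|n_gt0] := posnP n; first by rewrite expn0; lia.
move=> _ _; rewrite !weaver_ptE// => /(mulIf _).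
rewrite invr_eq0 gt_eqF ?expn2B1_gt0// => /(_ isT)/eqP.
by rewrite eqr_nat => /eqP.
Qed.

Lemma weaver_pt_last p n : (0 < n)%N -> weaver_pt p n (2 ^ n - 1) = 1.
Proof. by move=> n_gt0; rewrite weaver_ptE// divff// gt_eqF// expn2B1_gt0. Qed.

Lemma le_weaver_pt p n j k : (0 < n)%N ->
  (weaver_pt p n j <= weaver_pt p n k) = (j <= k)%N.
Proof.
move=> n_gt0; rewrite !weaver_ptE// ler_pM2r ?ler_nat// invr_gt0.
exact: expn2B1_gt0.
Qed.

Lemma weaver_pt_reflect p n k : (k < 2 ^ n)%N ->
  weaver_pt (1 - p) n (2 ^ n - 1 - k) = 1 - weaver_pt p n k.
Proof.
have [->//|n_gt0 lt_k] := posnP n; rewrite !weaver_ptE//.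
have N_neq0 : (2 ^ n - 1)%N%:R != 0 :> R by rewrite gt_eqF// expn2B1_gt0.
by rewrite -[X in X - _](divff N_neq0) -mulrBl -natrB//; lia.
Qed.

End Points.

(** * The law on dyadic intervals *)

Section Law.
Context {R : realType} (p : R).
Hypotheses (p_gt0 : 0 < p) (p_lt1 : p < 1).

(** For [n + d > 0], with [N = 2 ^ n] and [D = 2 ^ d], clearing denominators turns
    [k / N <= j / (N D - 1)] into [(k D - j) N <= k]; as [k < N], this means
    [k D <= j]. *)
Lemma dyadic_le_weaver_pt n d k j : (k < 2 ^ n)%N -> (j < 2 ^ (n + d))%N ->
  (dyadic n k <= weaver_pt p (n + d) j) = (k * 2 ^ d <= j)%N.
Proof.
move=> lt_k lt_j; have [/eqP nd0|nd_gt0] := posnP (n + d).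
  move: nd0 lt_k lt_j; rewrite addn_eq0 => /andP[/eqP -> /eqP ->].
  rewrite !expn0 !ltnS !leqn0 => /eqP -> /eqP ->.
  by rewrite /dyadic /weaver_pt mul0r ltW.
rewrite weaver_ptE// /dyadic ler_pdivrMr ?exprn_gt0// mulrAC ler_pdivlMr ?expn2B1_gt0//.
rewrite -natrX -!natrM ler_nat expnD.
have := expn_gt0 2 n; have := expn_gt0 2 d; rewrite expnD in lt_j; move: lt_k lt_j => /=.
by move: (2 ^ n)%N (2 ^ d)%N => N D ? ? ? ?; apply/idP/idP; nia.
Qed.

(** The inequality reads [k <= (k D - j) N] (same notation), and as
    [0 < k <= N] this means [j < k D]: together with the previous lemma, no
    interior dyadic point is ever a support point. *)
Lemma weaver_pt_le_dyadic n d k j : (0 < k <= 2 ^ n)%N -> (j < 2 ^ (n + d))%N ->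
  (weaver_pt p (n + d) j <= dyadic n k) = (j < k * 2 ^ d)%N.
Proof.
move=> /andP[k_gt0 le_k] lt_j; have [/eqP nd0|nd_gt0] := posnP (n + d).
  move: nd0 le_k lt_j; rewrite addn_eq0 => /andP[/eqP -> /eqP ->].
  rewrite !expn0 muln1 => le_k lt_j.
  have [-> ->] : j = 0%N /\ k = 1%N by lia.
  by rewrite /dyadic /weaver_pt expr0 divr1 ltW.
rewrite weaver_ptE// /dyadic ler_pdivlMr ?exprn_gt0// mulrAC ler_pdivrMr ?expn2B1_gt0//.
rewrite -natrX -!natrM ler_nat expnD.
have := expn_gt0 2 n; have := expn_gt0 2 d; rewrite expnD in lt_j; move: le_k lt_j => /=.
by move: (2 ^ n)%N (2 ^ d)%N => N D ? ? ? ?; apply/idP/idP; nia.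
Qed.

Lemma weaver_probE n A :
  weaver_prob p n A = (\sum_(k < 2 ^ n | weaver_pt p n k \in A) weaver_pmf p n k)%:E.
Proof.
rewrite /weaver_prob (ltW p_gt0) (ltW p_lt1) /= -sumEFin big_mkcond [RHS]big_mkcond /=.
apply: eq_bigr => k _; rewrite diracE; case: ifP => _; first by rewrite mule1.
by rewrite mule0.
Qed.

(** Every set measured at dyadic points selects an integer interval of indices,
    which makes its probability a sum of consecutive masses. *)
Lemma weaver_prob_range n a b A : (b <= 2 ^ n)%N ->
  (forall j, (j < 2 ^ n)%N -> (weaver_pt p n j \in A) = (a <= j < b)%N) ->
  weaver_prob p n A = (\sum_(a <= j < b) weaver_pmf p n j)%:E.
Proof.
move=> le_b memA; rewrite weaver_probE; congr (_%:E).
rewrite (@big_nat_widenl _ _ _ a 0)// (big_nat_widen _ _ (2 ^ n)%N)// big_mkord.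
by apply: eq_bigl => j; rewrite memA ?ltn_ord//= andbC.
Qed.

Lemma weaver_prob_pt n k : (k < 2 ^ n)%N ->
  weaver_prob p n [set weaver_pt p n k] = (weaver_pmf p n k)%:E.
Proof.
move=> lt_k; rewrite (@weaver_prob_range n k k.+1)//; first by rewrite big_nat1.
move=> j lt_j; rewrite ltnS -eqn_leq eq_sym; apply/idP/eqP => [|->]; rewrite inE //=.
exact: weaver_pt_inj.
Qed.

Lemma weaver_prob_le n A B : A `<=` B -> (weaver_prob p n A <= weaver_prob p n B)%E.
Proof.
move=> subAB; rewrite !weaver_probE lee_fin [leLHS]big_mkcond [leRHS]big_mkcond.
apply: ler_sum => k _; have w0 := ltW (weaver_pmf_gt0 n k p_gt0 p_lt1).
case: ifPn => [|_]; last by case: ifP.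
by rewrite inE => /subAB/mem_set ->.
Qed.

Lemma weaver_cdfE n x :
  weaver_cdf p n x = \sum_(k < 2 ^ n | weaver_pt p n k <= x) weaver_pmf p n k.
Proof.
rewrite /weaver_cdf /cdf /distribution /pushforward /= weaver_probE /=.
by apply: eq_bigl => k; rewrite mem_setE in_itv.
Qed.

Lemma weaver_prob_dyadic_lt n d k : (0 < k < 2 ^ n)%N ->
  weaver_prob p (n + d) `]-oo, dyadic n k[ = (\sum_(0 <= i < k) weaver_pmf p n i)%:E.
Proof.
move=> /andP[k_gt0 lt_k]; rewrite -(sum_weaver_pmf_prefix p n d).
apply: weaver_prob_range => [|j lt_j]; first by rewrite expnD leq_mul2r ltnW ?orbT.
by rewrite mem_setE in_itv /= ltNge dyadic_le_weaver_pt// -ltnNge.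
Qed.

Lemma weaver_prob_dyadic_le n d k : (0 < k <= 2 ^ n)%N ->
  weaver_prob p (n + d) `]-oo, dyadic n k] = (\sum_(0 <= i < k) weaver_pmf p n i)%:E.
Proof.
move=> /andP[k_gt0 le_k]; rewrite -(sum_weaver_pmf_prefix p n d).
apply: weaver_prob_range => [|j lt_j]; first by rewrite expnD leq_mul2r le_k orbT.
by rewrite mem_setE in_itv /= weaver_pt_le_dyadic// k_gt0.
Qed.

Lemma weaver_prob_dyadic_gt n d k : (0 < k < 2 ^ n)%N ->
  weaver_prob p (n + d) `]dyadic n k, +oo[ =
  (\sum_(k <= i < 2 ^ n) weaver_pmf p n i)%:E.
Proof.
move=> /andP[k_gt0 lt_k].
rewrite (@weaver_prob_range (n + d) (k * 2 ^ d) (2 ^ (n + d)))//.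
  congr (_%:E); have total m := sum_weaver_pmf p m.
  move: (total (n + d)%N) (total n); rewrite -!(big_mkord xpredT).
  rewrite (@big_cat_nat _ _ _ (k * 2 ^ d))//=; last by rewrite expnD leq_mul2r ltnW ?orbT.
  rewrite sum_weaver_pmf_prefix => <-.
  by rewrite (@big_cat_nat _ _ _ k)//= 1?ltnW// => /addrI.
move=> j lt_j; rewrite mem_setE in_itv /= andbT lt_j andbT ltNge.
by rewrite weaver_pt_le_dyadic -?leqNgt// k_gt0 ltnW.
Qed.

Lemma weaver_cdf_dyadic n d k : (0 < k <= 2 ^ n)%N ->
  weaver_cdf p (n + d) (dyadic n k) = \sum_(0 <= i < k) weaver_pmf p n i.
Proof.
move=> k_bnd; rewrite /weaver_cdf /cdf /distribution /pushforward /=.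
by rewrite weaver_prob_dyadic_le.
Qed.

Lemma weaver_pt_in_dyadic n d k j : (k < 2 ^ n)%N -> (j < 2 ^ (n + d))%N ->
  (weaver_pt p (n + d) j \in `[dyadic n k, dyadic n k.+1]) =
  (k * 2 ^ d <= j < k.+1 * 2 ^ d)%N.
Proof.
by move=> lt_k lt_j; rewrite in_itv /= dyadic_le_weaver_pt// weaver_pt_le_dyadic.
Qed.

Lemma weaver_prob_dyadic_itv n d k : (k < 2 ^ n)%N ->
  weaver_prob p (n + d) `[dyadic n k, dyadic n k.+1] = (weaver_pmf p n k)%:E.
Proof.
move=> lt_k; rewrite -(sum_weaver_pmf_block p n d).
apply: weaver_prob_range => [|j lt_j]; first by rewrite expnD leq_mul2r lt_k orbT.
by rewrite mem_setE weaver_pt_in_dyadic.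
Qed.

Lemma weaver_prob_itv_off_pt n k : (k < 2 ^ n)%N ->
  weaver_prob p n (`[dyadic n k, dyadic n k.+1] `\ weaver_pt p n k) = 0%E.
Proof.
move=> lt_k; rewrite (@weaver_prob_range n 0 0)//; first by rewrite big_geq.
move=> j lt_j; rewrite andbF; apply/negP; rewrite inE => -[/=].
have := @weaver_pt_in_dyadic n 0 k j lt_k; rewrite !addn0 => /(_ lt_j) ->.
by rewrite expn0 !muln1 ltnS -eqn_leq => /eqP ->.
Qed.

(** On the open interval only the [k]-th summand of the density is nonzero, and the
    endpoints are negligible. *)
Lemma pmodel_prob_itv n k : (k < 2 ^ n)%N ->
  pmodel_prob p n `[dyadic n k, dyadic n k.+1] = (weaver_pmf p n k)%:E.
Proof.
move=> lt_k; have N_gt0 : 0 < (2 : R) ^+ n by rewrite exprn_gt0.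
have dlt a b : (dyadic n a < dyadic n b :> R) = (a < b)%N.
  by rewrite /dyadic ltr_pM2r ?invr_gt0// ltr_nat.
set h := weaver_pmf p n k / (dyadic n k.+1 - dyadic n k).
have density_const : {in `]dyadic n k, dyadic n k.+1[%classic,
    cst h%:E =1 (fun x => (pmodel_density p n x)%:E)}.
  move=> x; rewrite mem_setE in_itv /= => /andP[lt_x x_lt]; congr (_%:E).
  rewrite /pmodel_density (bigD1 (Ordinal lt_k))//= big1 ?addr0.
    by rewrite indicE mem_set ?mulr1 ?pmodel_massE//= in_itv /= lt_x.
  move=> j /eqP ne_j; rewrite indicE memNset ?mulr0//= in_itv /= => /andP[jx xj].
  apply: ne_j; apply/val_inj => /=.
  have := lt_trans jx x_lt; have := lt_trans lt_x xj; rewrite !dlt; lia.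
rewrite /pmodel_prob integral_itv_bndoo; last first.
  apply: eq_measurable_fun; first exact: density_const.
  exact: measurable_cst.
rewrite (eq_integral (cst h%:E)) => [|x /density_const ->//].
rewrite integral_cst//.
have leb : lebesgue_measure (`]dyadic n k, dyadic n k.+1[%classic : set R) =
    (dyadic n k.+1 - dyadic n k)%:E.
  by rewrite lebesgue_measure_itv /= lte_fin dlt ltnSn.
transitivity (h%:E * (dyadic n k.+1 - dyadic n k)%:E)%E.
  by congr (_ * _)%E; exact: leb.
by rewrite -EFinM /h divfK// subr_eq0 gt_eqF// dlt.
Qed.

End Law.

(** * Reflection, modes and medians *)

Section Descriptors.
Context {R : realType}.
Implicit Types p : R.

Lemma weaver_prob_reflect p n A : 0 < p -> p < 1 ->
  weaver_prob (1 - p) n A = weaver_prob p n ((fun x => 1 - x) @^-1` A).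
Proof.
move=> p_gt0 p_lt1; rewrite !weaver_probE ?subr_gt0 ?gtrBl//; congr (_%:E).
have revE (k : 'I_(2 ^ n)) : rev_ord k = (2 ^ n - 1 - k)%N :> nat.
  by rewrite /= -subnDA add1n.
rewrite (reindex_inj rev_ord_inj); apply: eq_big => k; last first.
  by rewrite revE weaver_pmf_reflect.
rewrite revE.
rewrite weaver_pt_reflect//; apply/idP/idP; rewrite !inE.
Qed.

Lemma is_mode_reflect p n x : 0 < p -> p < 1 ->
  is_mode (weaver_prob (1 - p) n) x <-> is_mode (weaver_prob p n) (1 - x).
Proof.
move=> p_gt0 p_lt1; rewrite /is_mode.
have pre (y : R) : (fun x => 1 - x) @^-1` [set y] = [set 1 - y].
  by apply/seteqP; split => z /= => [<-|->]; rewrite subKr.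
split=> mode y; last by rewrite !weaver_prob_reflect// !pre.
by have := mode (1 - y); rewrite !weaver_prob_reflect// !pre subKr.
Qed.

Lemma is_median_reflect p n x : 0 < p -> p < 1 ->
  is_median (weaver_prob (1 - p) n) x <-> is_median (weaver_prob p n) (1 - x).
Proof.
move=> p_gt0 p_lt1; rewrite /is_median !weaver_prob_reflect//.
have -> : (fun x : R => 1 - x) @^-1` `]-oo, x] = `[1 - x, +oo[%classic.
  by apply/seteqP; split => z /=; rewrite !in_itv /= ?andbT; lra.
have -> : (fun x : R => 1 - x) @^-1` `[x, +oo[ = `]-oo, 1 - x]%classic.
  by apply/seteqP; split => z /=; rewrite !in_itv /= ?andbT; lra.
by split=> -[].
Qed.

(** The all-ones index is the only one of mass [p ^+ n]; points outside the support
    have mass zero. *)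
Lemma weaver_prob_mode p n x : 1 / 2 < p -> p < 1 -> (0 < n)%N ->
  is_mode (weaver_prob p n) x <-> x = 1.
Proof.
move=> p_gt p_lt1 n_gt0; have p_gt0 : 0 < p by lra.
have last_lt : (2 ^ n - 1 < 2 ^ n)%N by have := expn_gt0 2 n; lia.
have prob1 : weaver_prob p n [set 1] = (p ^+ n)%:E.
  by rewrite -(weaver_pt_last p n_gt0) weaver_prob_pt// weaver_pmf_last.
have atom y : (exists2 k, (k < 2 ^ n)%N & y = weaver_pt p n k) \/
    weaver_prob p n [set y] = 0%E.
  have [[k ?]|none] := pselect (exists k : 'I_(2 ^ n), y = weaver_pt p n k).
    by left; exists k.
  right; rewrite weaver_probE// big_pred0// => k.
  by apply/negP; rewrite inE => yk; apply: none; exists k.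
split=> [mode|-> y].
  have := mode 1; rewrite prob1; have [[k lt_k ->]|->] := atom x; last first.
    by rewrite lee_fin leNgt exprn_gt0.
  rewrite weaver_prob_pt// lee_fin => le_k.
  have [lt_kl|ge_kl] := ltnP k (2 ^ n - 1).
    by have := weaver_pmf_lt_max p_gt p_lt1 lt_kl; rewrite ltNge le_k.
  by rewrite (_ : k = 2 ^ n - 1)%N ?weaver_pt_last//; lia.
rewrite prob1; have [[k lt_k ->]|->] := atom y.
  by rewrite weaver_prob_pt// lee_fin weaver_pmf_le_max.
by rewrite lee_fin exprn_ge0// ltW.
Qed.

(** The mass up to [1 / 2] is [1 - p], too small for a median. *)
Lemma weaver_median_gt_half p n m : 1 / 2 < p -> p < 1 -> (0 < n)%N ->
  is_median (weaver_prob p n) m -> 1 / 2 < m.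
Proof.
move=> p_gt p_lt1 n_gt0 [le_m _]; have p_gt0 : 0 < p by lra.
rewrite ltNge; apply/negP => m_le.
have: (weaver_prob p n `]-oo, m] <= (1 - p)%:E)%E.
  apply: (@le_trans _ _ (weaver_prob p n `]-oo, dyadic 1 1])).
    apply: weaver_prob_le => // y /=; rewrite !in_itv /= => /le_trans; apply.
    by rewrite /dyadic expr1.
  case: n n_gt0 {le_m} => // n _; rewrite -add1n weaver_prob_dyadic_le//.
  by rewrite big_nat1 weaver_pmfS weaver_pmf0 mulr1.
by move=> /(le_trans le_m); rewrite lee_fin; lra.
Qed.

(** The median is the first support point at which the cumulated mass reaches one
    half. *)
Lemma weaver_median_exists p n : 0 < p -> p < 1 -> (0 < n)%N ->
  exists m, is_median (weaver_prob p n) m.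
Proof.
move=> p_gt0 p_lt1 n_gt0.
have S_total : \sum_(0 <= i < 2 ^ n) weaver_pmf p n i = 1.
  by rewrite big_mkord sum_weaver_pmf.
pose reached K := 2^-1 <= \sum_(0 <= i < K) weaver_pmf p n i.
have ex : exists K, reached K by exists (2 ^ n)%N; rewrite /reached S_total; lra.
(* K = k + 1 is the least number of points whose total mass reaches one half *)
case: (ex_minnP ex) => -[|k] reachedK minK.
  by move: reachedK; rewrite /reached big_geq//; lra.
have lt_k : (k < 2 ^ n)%N by apply: minK; rewrite /reached S_total; lra.
have lt_half : \sum_(0 <= i < k) weaver_pmf p n i < 2^-1.
  by rewrite ltNge; apply/negP => /minK; rewrite ltnn.
exists (weaver_pt p n k); split.
  rewrite (@weaver_prob_range _ _ p_gt0 p_lt1 n 0 k.+1)// => j lt_j.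
  by rewrite mem_setE in_itv /= le_weaver_pt.
rewrite (@weaver_prob_range _ _ p_gt0 p_lt1 n k (2 ^ n))// => [|j lt_j].
  move: S_total; rewrite (@big_cat_nat _ _ _ k)//= 1?ltnW// lee_fin.
  lra.
by rewrite mem_setE in_itv /= andbT le_weaver_pt// lt_j andbT.
Qed.

Lemma weaver_prob_uniform n A :
  weaver_prob (1 / 2 : R) n A =
  (#|[set k : 'I_(2 ^ n) | weaver_pt (1 / 2) n k \in A]%SET|%:R / 2 ^+ n)%:E.
Proof.
rewrite weaver_probE; [|lra..]; congr (_%:E).
under eq_bigr do rewrite weaver_pmf_half.
by rewrite sumr_const cardsE div1r -[LHS]mulr_natl.
Qed.

End Descriptors.

(** * Discontinuities and jump sizes *)

Section Jumps.
Context {R : realType}.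

Lemma card_set_seq (T : choiceType) (s : seq T) :
  uniq s -> ([set` s] #= `I_(size s))%card.
Proof.
move=> uniq_s; have [->|] := eqVneq s [::]; first by rewrite /= II0 set_nil.
case: s uniq_s => // x0 s' => uniq_s _; set s := x0 :: s' in uniq_s *.
rewrite (_ : [set` s] = nth x0 s @` `I_(size s)).
  apply: inj_card_eq => i j; rewrite !inE /= => lt_i lt_j /eqP.
  by rewrite nth_uniq// => /eqP.
apply/seteqP; split => [x /= /(nthP x0)[i lt_i <-]|x [i /= lt_i <-]].
  by exists i.
exact: mem_nth.
Qed.

Variable (p : R).
Hypotheses (p_gt0 : 0 < p) (p_lt1 : p < 1).

Lemma weaver_cdf_step n :
  weaver_cdf p n = fun x => \sum_(k < 2 ^ n | weaver_pt p n k <= x) weaver_pmf p n k.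
Proof. by apply/funext => x; exact: weaver_cdfE. Qed.

Lemma sum_weaver_pmf_at n k : (k < 2 ^ n)%N ->
  \sum_(j < 2 ^ n | weaver_pt p n j == weaver_pt p n k) weaver_pmf p n j =
  weaver_pmf p n k.
Proof.
move=> lt_k; rewrite (big_pred1 (Ordinal lt_k))// => j.
apply/eqP/eqP => [|->//] /weaver_pt_inj eq_jk.
by apply/val_inj; rewrite /= eq_jk.
Qed.

Lemma jump_weaver_cdf n k : (k < 2 ^ n)%N ->
  jump (weaver_cdf p n) (weaver_pt p n k) = weaver_pmf p n k.
Proof. by move=> lt_k; rewrite weaver_cdf_step jump_step sum_weaver_pmf_at. Qed.

(** All masses are positive, so every support point is a discontinuity. *)
Lemma discontinuities_weaver_cdf n :
  discontinuities (weaver_cdf p n) = [set weaver_pt p n k | k in `I_(2 ^ n)].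
Proof.
rewrite weaver_cdf_step; apply/seteqP; split => x.
  move=> /discontinuities_step sum_neq0.
  have [[k <-]|none] := pselect (exists k : 'I_(2 ^ n), weaver_pt p n k = x).
    by exists k => //=.
  exfalso; apply: sum_neq0; apply: big_pred0 => k.
  by apply/eqP => pt_k; apply: none; exists k.
move=> [k /= lt_k <-]; apply/discontinuities_step.
by rewrite sum_weaver_pmf_at//; apply/eqP; rewrite gt_eqF// weaver_pmf_gt0.
Qed.

(** Distinct indices give distinct points, so sets of support points are counted
    through their indices. *)
Lemma card_weaver_pts n (P : pred nat) :
  ([set weaver_pt p n k | k in [set k | (k < 2 ^ n)%N && P k]]
    #= `I_(count P (iota 0 (2 ^ n))))%card.
Proof.
set K := [set k | _]; have K_inj : {in K &, injective (weaver_pt p n)}.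
  by move=> j k; rewrite !inE /= => /andP[lt_j _] /andP[lt_k _]; exact: weaver_pt_inj.
apply: card_eq_trans (inj_card_eq K_inj) _.
rewrite -size_filter (_ : K = [set` [seq k <- iota 0 (2 ^ n) | P k]]).
  exact: card_set_seq (filter_uniq _ (iota_uniq _ _)).
by apply/seteqP; split => k /=; rewrite mem_filter mem_iota add0n /= andbC.
Qed.

Definition jump_size n j := p ^+ j * (1 - p) ^+ (n - j).

(** An equality of two sizes simplifies to [(1 - p) ^+ d = p ^+ d] with
    [d > 0]. *)
Lemma jump_size_inj n : p <> 1 / 2 -> {in `I_n.+1 &, injective (jump_size n)}.
Proof.
move=> p_neq; have q_gt0 : 0 < 1 - p by rewrite subr_gt0.
have neq i j : (i < j <= n)%N -> jump_size n i <> jump_size n j.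
  move=> /andP[lt_ij le_jn]; rewrite /jump_size.
  rewrite (_ : n - i = (j - i) + (n - j))%N; last by lia.
  rewrite -[X in _ = p ^+ X * _](subnKC (ltnW lt_ij)) !exprD -!mulrA.
  move=> /(mulfI _); rewrite expf_neq0 ?gt_eqF// => /(_ isT) /(mulIf _).
  rewrite expf_neq0 ?gt_eqF// => /(_ isT) /eqP.
  by rewrite eqrXn2 ?subn_gt0// ?ltW// => /eqP; lra.
move=> i j; rewrite !inE /= !ltnS => le_i le_j eq_h.
case: (ltngtP i j) => // lt_ij; first by case: (@neq i j); rewrite ?lt_ij.
by case: (@neq j i); rewrite ?lt_ij.
Qed.

(** Every size occurs: ['C(n, j) > 0] indices have exactly [j] ones. *)
Lemma jumps_weaver_cdf n :
  [set jump (weaver_cdf p n) x | x in discontinuities (weaver_cdf p n)] =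
  [set jump_size n j | j in `I_n.+1].
Proof.
rewrite discontinuities_weaver_cdf; apply/seteqP; split => y.
  move=> [_ [k /= lt_k <-] <-]; exists (ones n k); first by rewrite /= ltnS ones_le.
  by rewrite jump_weaver_cdf// weaver_pmfE.
move=> [j /= lt_j <-].
have : has (fun k => ones n k == j) (iota 0 (2 ^ n)).
  by rewrite has_count count_ones bin_gt0.
move=> /hasP[k]; rewrite mem_iota add0n /= => lt_k /eqP ones_k.
exists (weaver_pt p n k); first by exists k.
by rewrite jump_weaver_cdf// weaver_pmfE ones_k.
Qed.

Lemma jump_size_mult n j : p <> 1 / 2 -> (j <= n)%N ->
  ([set x | discontinuities (weaver_cdf p n) x /\
            jump (weaver_cdf p n) x = jump_size n j] #= `I_('C(n, j)))%card.
Proof.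
move=> p_neq le_j; rewrite -count_ones.
rewrite (_ : [set x | _] =
  [set weaver_pt p n k | k in [set k | (k < 2 ^ n)%N && (ones n k == j)]]).
  exact: card_weaver_pts.
rewrite discontinuities_weaver_cdf; apply/seteqP; split => x /=.
  move=> [[k /= lt_k <-]]; rewrite jump_weaver_cdf// weaver_pmfE => eq_h.
  exists k => //=; rewrite lt_k; apply/eqP; apply: (jump_size_inj p_neq _ _ eq_h).
    by rewrite inE /= ltnS ones_le.
  by rewrite inE.
move=> [k /andP[lt_k /eqP ones_k] <-]; split; first by exists k.
by rewrite jump_weaver_cdf// weaver_pmfE ones_k.
Qed.

End Jumps.

(** * The properties of Weaver's distribution *)

Theorem theorem4 (R : realType) (p : R) (p_gt0 : 0 < p) (p_lt1 : p < 1) :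
  (* (i) *)
  ((forall n : nat, weaver_vec p n.+1 =
      [seq (1 - p) * x | x <- weaver_vec p n] ++
      [seq p * x | x <- weaver_vec p n]) /\
   (weaver_vec p 0 = [:: 1] /\
    forall n : nat, weaver_vec p n.+1 =
      flatten [seq [:: (1 - p) * x; p * x] | x <- weaver_vec p n])) /\
  (* (ii) *)
  (forall n : nat, (1 <= n)%N ->
    [/\ 1 / 2 < p ->
        [/\ forall i j : nat, (i < j)%N ->
              (p / (1 - p)) ^+ i * weaver_pmf p n 0 <
              (p / (1 - p)) ^+ j * weaver_pmf p n 0,
            forall x : R, is_mode (weaver_prob p n) x <-> x = 1,
            exists m : R, is_median (weaver_prob p n) m &
            forall m : R, is_median (weaver_prob p n) m -> 1 / 2 < m],
        p < 1 / 2 ->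
        [/\ forall i j : nat, (i < j)%N ->
              (p / (1 - p)) ^+ j * weaver_pmf p n 0 <
              (p / (1 - p)) ^+ i * weaver_pmf p n 0,
            forall x : R, is_mode (weaver_prob p n) x <-> x = 0,
            exists m : R, is_median (weaver_prob p n) m &
            forall m : R, is_median (weaver_prob p n) m -> m < 1 / 2] &
        p = 1 / 2 ->
        (forall k : nat, (k < 2 ^ n)%N -> weaver_pmf p n k = 1 / 2 ^+ n) /\
        (forall A : set R, measurable A ->
          weaver_prob p n A =
          (#|[set k : 'I_(2 ^ n) | weaver_pt p n k \in A]%SET|%:R
             / 2 ^+ n)%:E)]) /\
  (* (iii) *)
  (forall n : nat, (1 <= n)%N ->
   forall (d d' : measure_display)
     (T : measurableType d) (T' : measurableType d')
     (P : probability T R) (P' : probability T' R)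
     (Y : {RV P >-> R}) (Y' : {RV P' >-> R}),
   has_law Y (weaver_prob p n) -> has_law Y' (weaver_prob (1 - p) n) ->
   forall k : nat, (k < 2 ^ n)%N ->
     P [set t | Y t = weaver_pt p n k] =
     P' [set t | Y' t = weaver_pt (1 - p) n (2 ^ n - 1 - k)]) /\
  (* (iv) *)
  ((forall n k : nat, (0 < k)%N -> (k < 2 ^ n)%N ->
    forall m : nat, (n <= m)%N ->
      [/\ weaver_prob p m `]-oo, dyadic n k[ =
            weaver_prob p n `]-oo, dyadic n k[,
          weaver_prob p m `]dyadic n k, +oo[ =
            weaver_prob p n `]dyadic n k, +oo[ &
          weaver_cdf p m (dyadic n k) = weaver_cdf p n (dyadic n k)]) /\
   [/\ forall m : nat, (1 <= m)%N -> weaver_cdf p m (1 / 2) = 1 - p,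
       forall m : nat, (2 <= m)%N ->
         weaver_cdf p m (1 / 4) = (1 - p) ^+ 2 /\
         weaver_cdf p m (3 / 4) = 1 - p ^+ 2 &
       forall m : nat, (3 <= m)%N ->
         [/\ weaver_cdf p m (1 / 8) = (1 - p) ^+ 3,
             weaver_cdf p m (3 / 8) = (1 - p) ^+ 2 + p * (1 - p) ^+ 2,
             weaver_cdf p m (5 / 8) = (1 - p) + p * (1 - p) ^+ 2 &
             weaver_cdf p m (7 / 8) = 1 - p ^+ 3]]) /\
  (* (v) *)
  (forall n k : nat, (k < 2 ^ n)%N ->
    [/\ forall m : nat, (n <= m)%N ->
          weaver_prob p m `[dyadic n k, dyadic n k.+1] = (weaver_pmf p n k)%:E,
        weaver_pt p n k \in `[dyadic n k, dyadic n k.+1],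
        weaver_prob p n [set weaver_pt p n k] = (weaver_pmf p n k)%:E,
        weaver_prob p n
          (`[dyadic n k, dyadic n k.+1] `\ weaver_pt p n k) = 0%E &
        pmodel_prob p n `[dyadic n k, dyadic n k.+1] =
          weaver_prob p n `[dyadic n k, dyadic n k.+1]]) /\
  (* (vi) *)
  (forall n : nat, (1 <= n)%N ->
    let F := weaver_cdf p n in
    let h (j : nat) : R := p ^+ j * (1 - p) ^+ (n - j) in
    [/\ (discontinuities F #= `I_(2 ^ n))%card,
        p = 1 / 2 ->
          forall x : R, discontinuities F x -> jump F x = 1 / 2 ^+ n &
        p <> 1 / 2 ->
        [/\ [set jump F x | x in discontinuities F] =
              [set h j | j in `I_n.+1],
            ([set jump F x | x in discontinuities F] #= `I_n.+1)%card &
            forall j : nat, (j <= n)%N ->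
              ([set x | discontinuities F x /\ jump F x = h j]
                 #= `I_('C(n, j)))%card]]).
Proof.
split; last split; last split; last split; last split.
- split; first exact: weaver_vec_cat.
  by split; [rewrite /weaver_vec /mkseq /= weaver_pmf0 | exact: weaver_vec_flatten].
- move=> n n_gt0; have pmf0 := weaver_pmf_gt0 n 0 p_gt0 p_lt1.
  have q_gt0 : 0 < 1 - p by lra.
  split=> p_half.
  + split.
    * move=> i j lt_ij; rewrite ltr_pM2r// ltr_eXn2l// ltr_pdivlMr//; lra.
    * by move=> x; exact: weaver_prob_mode.
    * exact: weaver_median_exists.
    * by move=> m; exact: weaver_median_gt_half.
  (* the law for 1 - p is the reflection of the law for p *)
  + have q_half : 1 / 2 < 1 - p by lra.
    have q_lt1 : 1 - p < 1 by lra.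
    split.
    * move=> i j lt_ij; rewrite ltr_pM2r// ltr_iXn2l ?divr_gt0// ltr_pdivrMr//; lra.
    * move=> x; have := is_mode_reflect n (1 - x) p_gt0 p_lt1; rewrite subKr => <-.
      by rewrite weaver_prob_mode//; split; lra.
    * exact: weaver_median_exists.
    * move=> m; have := is_median_reflect n (1 - m) p_gt0 p_lt1; rewrite subKr => <-.
      by move=> /(weaver_median_gt_half q_half q_lt1 n_gt0); lra.
  + rewrite p_half; split=> [k _|A _]; first exact: weaver_pmf_half.
    exact: weaver_prob_uniform.
- move=> n n_gt0 d d' T T' P P' Y Y' lawY lawY' k lt_k.
  have := lawY [set weaver_pt p n k] (measurable_set1 _).
  rewrite /distribution /pushforward weaver_prob_pt// => ->.
  have := lawY' [set weaver_pt (1 - p) n (2 ^ n - 1 - k)] (measurable_set1 _).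
  rewrite /distribution /pushforward weaver_prob_pt ?subr_gt0 ?gtrBl//; last by lia.
  by rewrite weaver_pmf_reflect// => ->.
- split.
    move=> n k k_gt0 lt_k m /subnKC <-.
    have k_bnd : (0 < k < 2 ^ n)%N by rewrite k_gt0.
    have k_le : (0 < k <= 2 ^ n)%N by rewrite k_gt0 ltnW.
    have lt0 := @weaver_prob_dyadic_lt R p p_gt0 p_lt1 n 0 k k_bnd.
    have gt0 := @weaver_prob_dyadic_gt R p p_gt0 p_lt1 n 0 k k_bnd.
    have cdf0 := @weaver_cdf_dyadic R p p_gt0 p_lt1 n 0 k k_le.
    rewrite addn0 in lt0 gt0 cdf0.
    by rewrite lt0 gt0 cdf0 weaver_prob_dyadic_lt// weaver_prob_dyadic_gt//
      weaver_cdf_dyadic.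
  have cdfE n k m : (n <= m)%N -> (0 < k <= 2 ^ n)%N ->
      weaver_cdf p m (k%:R / (2 ^ n)%:R) = \sum_(0 <= i < k) weaver_pmf p n i.
    by move=> /subnKC <- k_bnd; rewrite natrX weaver_cdf_dyadic.
  split=> m le_m.
  + by rewrite (cdfE 1 1)// big_nat1 weaver_pmfS weaver_pmf0 mulr1.
  + rewrite (cdfE 2 1)// (cdfE 2 3)//.
    by split; rewrite !big_nat_recr//= big_geq// !weaver_pmfS !weaver_pmf0 /=; ring.
  + rewrite (cdfE 3 1)// (cdfE 3 3)// (cdfE 3 5)// (cdfE 3 7)//.
    by split; rewrite !big_nat_recr//= big_geq// !weaver_pmfS !weaver_pmf0 /=; ring.
- move=> n k lt_k; have mass := @weaver_prob_dyadic_itv R p p_gt0 p_lt1 n 0 k lt_k;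
  rewrite addn0 in mass.
  split.
  + by move=> m /subnKC <-; exact: weaver_prob_dyadic_itv.
  + have := @weaver_pt_in_dyadic R p p_gt0 p_lt1 n 0 k k lt_k; rewrite addn0 => -> //.
    by rewrite expn0 !muln1 leqnn ltnSn.
  + exact: weaver_prob_pt.
  + exact: weaver_prob_itv_off_pt.
  + by rewrite mass pmodel_prob_itv.
- move=> n n_gt0 F h; rewrite -/(jump_size p n) /F; split.
  + rewrite discontinuities_weaver_cdf//.
    apply: inj_card_eq => j k; rewrite !inE /= => lt_j lt_k.
    exact: weaver_pt_inj.
  + move=> p_half x; rewrite discontinuities_weaver_cdf// => -[k /= lt_k <-].
    by rewrite jump_weaver_cdf// p_half weaver_pmf_half.
  + move=> p_neq; split; first exact: jumps_weaver_cdf.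
      rewrite jumps_weaver_cdf//.
      exact: inj_card_eq (jump_size_inj p_gt0 p_lt1 p_neq).
    by move=> j le_j; exact: jump_size_mult.
Qed.
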